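(* Assume that $f_1$ is convex and that $f_2$, $f_3$ and $h$ are convex and Lipschitz continuous. Let $L_{\mathrm{obj}}>0$ be the Lipschitz constant with respect to the $r$-norm of the mapping $(x,y)\mapsto f_2(x)+f_3(y)$ and let $L_{\mathrm{con}}>0$ be the Lipschitz constant with respect to the $r$-norm of $h$. Consider the distributionally robust problem $$\text{(R)}\qquad\begin{aligned}\min_{g}\ \sup_{\mathbb{Q}\in B_\epsilon(\widehat{\mathbb{P}}_N)}\ &\mathbb{E}_{\mathbb{Q}}\big[f_1(\widehat U_{\mathrm f}g)+f_2(Y_{\mathrm f}g)+f_3(Y_{\mathrm p}g-\hat y_{\mathrm{ini}})\big]\\ \text{s.t.}\quad&\widehat U_{\mathrm p}g=\hat u_{\mathrm{ini}},\quad \widehat U_{\mathrm f}g\in\mathcal{U},\\ &\sup_{\mathbb{Q}\in B_\epsilon(\widehat{\mathbb{P}}_N)}\mathrm{CVaR}^{\mathbb{Q}}_{1-\alpha}(h(Y_{\mathrm f}g))\le 0\end{aligned}$$ and the problem $$\text{(T)}\qquad\begin{aligned}\min_{g,\tau,s_i}\ & f_1(\widehat U_{\mathrm f}g)+\frac1N\sum_{i=1}^N\Big(f_2(\widehat Y_{\mathrm f}^{(i)}g)+f_3(\widehat Y_{\mathrm p}^{(i)}g-\hat y_{\mathrm{ini}})\Big)+L_{\mathrm{obj}}\,\epsilon\,\|g\|_{r,\ast}\\ \text{s.t.}\quad&\widehat U_{\mathrm p}g=\hat u_{\mathrm{ini}},\quad \widehat U_{\mathrm f}g\in\mathcal{U},\\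 &-\tau\alpha+L_{\mathrm{con}}\,\epsilon\,\|g\|_{r,\ast}+\frac1N\sum_{i=1}^N s_i\le 0,\\ &\tau+h(\widehat Y_{\mathrm f}^{(i)}g)\le s_i\quad\forall i\le N,\\ & s_i\ge0\quad\forall i\le N,\end{aligned}$$ where $g\in\mathbb{R}^\kappa$ and $\tau,s_1,\dots,s_N\in\mathbb{R}$. Then: (1) the optimal value of (R) is upper bounded by the optimal value of (T); (2) the solution $\hat g^\star$ of (T) (the $g$-component of an optimizer) satisfies $\mathrm{CVaR}^{\mathbb{Q}}_{1-\alpha}(h(Y_{\mathrm f}\hat g^\star))\le0$ for all $\mathbb{Q}\in B_\epsilon(\widehat{\mathbb{P}}_N)$; (3) the objective of (T) coincides, as a function of $g$, with the objective of (R) when $\Xi=\mathbb{R}^{p(T_{\mathrm{ini}}+T_{\mathrm f})\kappa}$.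
   Context: Let $m,p,T_{\mathrm{ini}},T_{\mathrm f},T,N$ be positive integers with $\kappa:=\lfloor T/(T_{\mathrm{ini}}+T_{\mathrm f})\rfloor\ge1$. Input data: for a recorded input sequence $\hat u_{[1,T]}=(\hat u_1,\dots,\hat u_T)$, $\hat u_j\in\mathbb{R}^m$, let $\mathscr{P}_{L}(\hat u_{[1,T]})$ with $L=T_{\mathrm{ini}}+T_{\mathrm f}$ be the Page matrix, whose $j$-th column ($j=1,\dots,\kappa$) is the stacked vector $(\hat u_{(j-1)L+1}^\top,\dots,\hat u_{jL}^\top)^\top$. It is partitioned as $\begin{pmatrix}\widehat U_{\mathrm p}\\ \widehat U_{\mathrm f}\end{pmatrix}$ with $\widehat U_{\mathrm p}\in\mathbb{R}^{mT_{\mathrm{ini}}\times\kappa}$ and $\widehat U_{\mathrm f}\in\mathbb{R}^{mT_{\mathrm f}\times\kappa}$. The vectors $\hat u_{\mathrm{ini}}\in\mathbb{R}^{mT_{\mathrm{ini}}}$, $\hat y_{\mathrm{ini}}\in\mathbb{R}^{pT_{\mathrm{ini}}}$ (most recent measurements) are fixed, and $\mathcal{U}\subseteq\mathbb{R}^{mT_{\mathrm f}}$ is a given constraint set. Output data: the output data matrix $\begin{pmatrix}Y_{\mathrm p}\\ Y_{\mathrm f}\end{pmatrix}$, $Y_{\mathrm p}\in\mathbb{R}^{pT_{\mathrm{ini}}\times\kappa}$, $Y_{\mathrm f}\in\mathbb{R}^{pT_{\mathrm f}\times\kappa}$, is random; $\xi=(\xi_1^\top,\dots,\xi_{p(T_{\mathrm{ini}}+T_{\mathrm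 f})}^\top)^\top\in\mathbb{R}^{p(T_{\mathrm{ini}}+T_{\mathrm f})\kappa}$ denotes the stacking of its rows, $\xi_i^\top\in\mathbb{R}^{\kappa}$ (as a row) being the $i$-th row. $\Xi\subseteq\mathbb{R}^{p(T_{\mathrm{ini}}+T_{\mathrm f})\kappa}$ is the support set of $\xi$. Recorded samples $\hat\xi^{(i)}\in\Xi$, $i=1,\dots,N$, correspond to output data matrices $\widehat Y_{\mathrm p}^{(i)},\widehat Y_{\mathrm f}^{(i)}$. The empirical distribution is $\widehat{\mathbb{P}}_N=\frac1N\sum_{i=1}^N\delta_{\hat\xi^{(i)}}$ ($\delta_x$ the Dirac distribution at $x$). When $\xi$ is distributed according to $\mathbb{Q}$, the matrices $Y_{\mathrm p},Y_{\mathrm f}$ in $\mathbb{E}_{\mathbb{Q}}$ and $\mathrm{CVaR}^{\mathbb{Q}}$ are the ones determined by $\xi$. Functions: $f_1:\mathbb{R}^{mT_{\mathrm f}}\to\mathbb{R}_{\ge0}$, $f_2:\mathbb{R}^{pT_{\mathrm f}}\to\mathbb{R}_{\ge0}$, $f_3:\mathbb{R}^{pT_{\mathrm{ini}}}\to\mathbb{R}_{\ge0}$, $h:\mathbb{R}^{pT_{\mathrm f}}\to\mathbb{R}$. ''The Lipschitz constant'' of a function with respect to a norm means its smallest Lipschitz constant. $\alpha\in(0,1)$ and $\epsilon\ge0$ are given. Norms: $r\in[1,\infty]$ is fixed, $\|\cdot\|_r$ is the $r$-norm, and $\|\cdot\|_{r,\ast}$ is its dual norm, i.e. the $q$-norm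 with $\frac1r+\frac1q=1$. Wasserstein ball: $\mathcal{M}(\Xi)$ is the set of probability distributions $\mathbb{Q}$ supported on $\Xi$ with $\mathbb{E}_{\mathbb{Q}}[\|\xi\|_r]<\infty$; $\mathrm{d}_{\mathrm W}(\mathbb{Q}_1,\mathbb{Q}_2)=\inf_\Pi\int_{\Xi^2}\|\xi_1-\xi_2\|_r\,\Pi(\mathrm d\xi_1,\mathrm d\xi_2)$, the infimum being over joint distributions $\Pi$ with marginals $\mathbb{Q}_1,\mathbb{Q}_2$; $B_\epsilon(\mathbb{Q})=\{\mathbb{Q}'\in\mathcal{M}(\Xi)\mid \mathrm{d}_{\mathrm W}(\mathbb{Q},\mathbb{Q}')\le\epsilon\}$. Conditional value at risk: for a real random variable $Z$ under $\mathbb{Q}$, $\mathrm{CVaR}^{\mathbb{Q}}_{1-\alpha}(Z)=\inf_{\tau\in\mathbb{R}}\{\tau+\frac1\alpha\mathbb{E}_{\mathbb{Q}}[(Z-\tau)_+]\}$, with $(a)_+=\max\{a,0\}$. *)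

(* Defs.v *)
From HB Require Import structures.
From mathcomp Require Import all_boot all_order all_algebra.
From mathcomp Require Import all_classical all_reals all_analysis.
Set Implicit Arguments.
Unset Strict Implicit.
Unset Printing Implicit Defensive.
Import Order.TTheory GRing.Theory Num.Theory.
Import numFieldNormedType.Exports.
Local Open Scope classical_set_scope.
Local Open Scope ring_scope.

(* Page matrices.  Row [i] of the stacked vector of a column is coordinate
   [i %% m] of its [i %/ m]-th sample; everything is indexed from 0, so column
   [j] holds the samples [j * L, ..., j * L + L - 1].  The trailing samples
   that do not fill a column are dropped. *)
Lemma page_coord_lt (m L : nat) (i : 'I_(m * L)) : (i %% m < m)%N.
Proof. by case: m i => [|m] [i] //=; rewrite ltn_pmod. Qed.

Lemma page_time_lt (m L T : nat) (i : 'I_(m * L)) (j : 'I_(T %/ L)) :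
  (j * L + i %/ m < T)%N.
Proof.
have m0 : (0 < m)%N by case: m i => [|//] [i] /=; rewrite mul0n.
have iL : (i %/ m < L)%N.
  by rewrite ltn_divLR//; apply: leq_trans (ltn_ord i) _; rewrite mulnC.
apply: (@leq_trans (j.+1 * L)); first by rewrite mulSn addnC ltn_add2r.
by apply: leq_trans (leq_divM T L); rewrite leq_mul2r ltn_ord orbT.
Qed.

Definition page (R : realType) (m L T : nat) (u : 'I_T -> 'cV[R]_m) :
    'M[R]_(m * L, T %/ L) :=
  \matrix_(i, j)
    u (Ordinal (page_time_lt i j)) (Ordinal (page_coord_lt i)) 0.

Section partition.
Context {R : realType} {k a b c : nat}.

Definition past (M : 'M[R]_(k * (a + b), c)) : 'M[R]_(k * a, c) :=
  usubmx (castmx (mulnDr k a b, erefl c) M).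

Definition future (M : 'M[R]_(k * (a + b), c)) : 'M[R]_(k * b, c) :=
  dsubmx (castmx (mulnDr k a b, erefl c) M).

End partition.

(* The matrix whose rows, stacked one after the other, form [xi]. *)
Definition unstack (R : realType) (n c : nat) (xi : 'cV[R]_(n * c)) :
    'M[R]_(n, c) :=
  vec_mx xi^T.

(* The r-norm; only exponents [1 <= r <= +oo] are meaningful. *)
Definition rnorm (R : realType) (r : \bar R) (n : nat) (x : 'cV[R]_n) : R :=
  match r with
  | s%:E => (\sum_i `|x i 0| `^ s) `^ s^-1
  | _ => \big[Num.max/0]_i `|x i 0|
  end.

Definition dual_rnorm (R : realType) (r : \bar R) (n : nat) (x : 'cV[R]_n) : R :=
  rnorm (hoelder_conjugate r) x.

Section lipschitz.
Context {R : realType} (r : \bar R) {n : nat} (F : 'cV[R]_n -> R).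

Definition lipschitz_bound (K : R) : Prop :=
  0 <= K /\ forall x y, `|F x - F y| <= K * rnorm r (x - y).

Definition lipschitz_continuous : Prop := exists K, lipschitz_bound K.

Definition lipschitz_constant (K : R) : Prop :=
  lipschitz_bound K /\ forall K', lipschitz_bound K' -> K <= K'.

End lipschitz.

(* R^n with its Borel sigma-algebra. *)
Notation borel R n := (g_sigma_algebraType (@open 'cV[R]_n)).

Section empirical.
Context {R : realType} {n N : nat} (x : 'I_N -> 'cV[R]_n).
Local Open Scope ereal_scope.

Definition empirical (A : set (borel R n)) : \bar R :=
  (N%:R^-1)%R%:E * \sum_(i < N) \d_(x i : borel R n) A.

Let dir (k : nat) : {measure set (borel R n) -> \bar R} :=
  if insub k is Some i then \d_(x i : borel R n) else mzero.

Let empiricalE : empirical = mscale (N%:R^-1 : R)%R%:nng%R (msum dir N).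
Proof.
apply/funext => A; rewrite /empirical /mscale /msum /=; congr (_ * _).
by apply: eq_bigr => i _; rewrite /dir valK.
Qed.

Let empirical0 : empirical set0 = 0.
Proof. by rewrite empiricalE measure0. Qed.

Let empirical_ge0 A : 0 <= empirical A.
Proof. by rewrite empiricalE. Qed.

Let empirical_sigma_additive : semi_sigma_additive empirical.
Proof. by rewrite empiricalE; exact: measure_semi_sigma_additive. Qed.

HB.instance Definition _ := isMeasure.Build _ _ _ empirical
  empirical0 empirical_ge0 empirical_sigma_additive.

End empirical.

Section wasserstein.
Context {R : realType} {n : nat} (Xi : set 'cV[R]_n) (r : \bar R).
Local Open Scope ereal_scope.

Definition finite_mean_on (Q : probability (borel R n) R) : Prop :=
  (\forall xi \ae Q, Xi xi) /\ 'E_Q[fun xi => rnorm r xi] < +oo.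

Definition coupling (P Q : {measure set (borel R n) -> \bar R})
    (Pi : probability (borel R n * borel R n)%type R) : Prop :=
  forall A, measurable A ->
    Pi (A `*` setT) = P A /\ Pi (setT `*` A) = Q A.

(* Between measures carried by [Xi], every coupling is carried by [Xi `*` Xi]. *)
Definition wasserstein (P Q : {measure set (borel R n) -> \bar R}) : \bar R :=
  ereal_inf [set \int[Pi]_(z in Xi `*` Xi)
                   (rnorm r ((z.1 : 'cV[R]_n) - (z.2 : 'cV[R]_n))%R)%:E
            | Pi in coupling P Q].

Definition wball (eps : R) (P : {measure set (borel R n) -> \bar R}) :
    set (probability (borel R n) R) :=
  [set Q | finite_mean_on Q /\ wasserstein P Q <= eps%:E].

End wasserstein.

(* Conditional value at risk at level [1 - alpha]. *)
Definition CVaR (R : realType) (alpha : R) d (S : measurableType d)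
    (Q : probability S R) (Z : S -> R) : \bar R :=
  ereal_inf [set (tau%:E + (alpha^-1)%:E *
                   'E_Q[fun w => (Num.max (Z w - tau) 0)%R])%E | tau in setT].

Section problems.
Context {R : realType} {m p Tini Tf N kappa : nat}.
Context (Up : 'M[R]_(m * Tini, kappa)) (Uf : 'M[R]_(m * Tf, kappa)).
Context (uini : 'cV[R]_(m * Tini)) (yini : 'cV[R]_(p * Tini)).
Context (U : set 'cV[R]_(m * Tf)).
Context (f1 : 'cV[R]_(m * Tf) -> R) (f2 : 'cV[R]_(p * Tf) -> R).
Context (f3 : 'cV[R]_(p * Tini) -> R) (h : 'cV[R]_(p * Tf) -> R).

Local Notation dim := (p * (Tini + Tf) * kappa)%N.

Definition Yp (xi : 'cV[R]_dim) : 'M[R]_(p * Tini, kappa) := past (unstack xi).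
Definition Yf (xi : 'cV[R]_dim) : 'M[R]_(p * Tf, kappa) := future (unstack xi).

Section robust.
Context (alpha : R) (B : set (probability (borel R dim) R)).

Definition robust_objective (g : 'cV[R]_kappa) : \bar R :=
  ereal_sup [set 'E_Q[fun xi => (f1 (Uf *m g) + f2 (Yf xi *m g)
                                 + f3 (Yp xi *m g - yini))%R]%E | Q in B].

Definition robust_feasible (g : 'cV[R]_kappa) : Prop :=
  [/\ Up *m g = uini, U (Uf *m g)
    & (ereal_sup [set CVaR alpha Q (fun xi => h (Yf xi *m g)) | Q in B]
       <= 0)%E].

Definition robust_value : \bar R :=
  ereal_inf [set robust_objective g | g in robust_feasible].

End robust.

Section tractable.
Context (r : \bar R) (alpha eps Lobj Lcon : R) (xihat : 'I_N -> 'cV[R]_dim).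

Definition tractable_objective (g : 'cV[R]_kappa) : R :=
  f1 (Uf *m g)
  + N%:R^-1 * (\sum_(i < N) (f2 (Yf (xihat i) *m g)
                             + f3 (Yp (xihat i) *m g - yini)))
  + Lobj * eps * dual_rnorm r g.

Definition tractable_feasible (g : 'cV[R]_kappa) (tau : R) (s : 'I_N -> R) :
    Prop :=
  [/\ Up *m g = uini, U (Uf *m g),
      - tau * alpha + Lcon * eps * dual_rnorm r g
        + N%:R^-1 * (\sum_(i < N) s i) <= 0,
      forall i, tau + h (Yf (xihat i) *m g) <= s i
    & forall i, 0 <= s i].

Definition tractable_value : \bar R :=
  ereal_inf [set (tractable_objective g)%:E
            | g in [set g | exists tau s, tractable_feasible g tau s]].

Definition tractable_optimizer (g : 'cV[R]_kappa) (tau : R) (s : 'I_N -> R) :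
    Prop :=
  tractable_feasible g tau s /\
  forall g' tau' s', tractable_feasible g' tau' s' ->
    tractable_objective g <= tractable_objective g'.

End tractable.
End problems.

(* Main.v *)
(* Row by row, Hoelder's inequality bounds the r-norm of [Y g] by that of the
   stacked [xi] times the dual norm of [g].  The cost and the risk are thus
   Lipschitz functions of [xi] with constants [Lobj * dual_rnorm r g] and
   [Lcon * dual_rnorm r g], and integrating the Lipschitz inequality against an
   almost optimal coupling bounds their expectations over the Wasserstein ball;
   for the CVaR one takes the infimum at [- tau].
   The bound on the cost is sharp when [Xi] is the whole space.  A slope of the
   convex cost close to [Lobj] persists along a ray, and Hoelder's inequality is
   attained on rank one perturbations of the data matrix.  Moving a fraction
   [th] of the mass by a distance [eps / th] along such a direction stays in the
   ball and, as [th] tends to 0, loses only [O(th)] against the bound. *)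
Require Import Defs.
From HB Require Import structures.
From mathcomp Require Import all_boot all_order all_algebra.
From mathcomp Require Import all_classical all_reals all_analysis.
From mathcomp Require Import measurable_realfun.
From mathcomp Require Import ring lra.
Set Implicit Arguments.
Unset Strict Implicit.
Unset Printing Implicit Defensive.
Import Order.TTheory GRing.Theory Num.Theory.
Import numFieldNormedType.Exports.
Local Open Scope classical_set_scope.
Local Open Scope ring_scope.

(** * The [r]-norms, Hoelder's inequality and its equality case *)

Section rnorm_theory.
Context {R : realType}.
Implicit Types (r : \bar R) (n : nat).

Lemma ge1_ereal_ind (P : \bar R -> Prop) :
  P +oo%E -> (forall s, 1 <= s -> P s%:E) -> forall r, (1 <= r)%E -> P r.
Proof. by move=> Py Ps [s r1|//|//]; apply: Ps; rewrite -lee_fin. Qed.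

Lemma rnorm_ge0 r n (x : 'cV[R]_n) : 0 <= rnorm r x.
Proof. by case: r => [s||]; [exact: powR_ge0|exact: bigmax_ge_id..]. Qed.

Lemma le_rnorm r n (x y : 'cV[R]_n) : (1 <= r)%E ->
  (forall i, `|x i 0| <= `|y i 0|) -> rnorm r x <= rnorm r y.
Proof.
move=> + xy; move: r; apply: ge1_ereal_ind => [|s s1].
  by apply: bigmax_le => [|i _]; [exact: bigmax_ge_id|exact: bigmax_sup (xy i)].
have s0 : 0 <= s by rewrite (le_trans ler01).
rewrite ge0_ler_powR ?invr_ge0 ?nnegrE ?sumr_ge0//.
by apply: ler_sum => i _; rewrite ge0_ler_powR ?nnegrE.
Qed.

Lemma rnormZ r n a (x : 'cV[R]_n) : (1 <= r)%E ->
  rnorm r (a *: x) = `|a| * rnorm r x.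
Proof.
move: r; apply: ge1_ereal_ind => [|s s1]; rewrite /rnorm.
  under eq_bigr do rewrite mxE normrM.
  apply/eqP; rewrite eq_le; apply/andP; split.
    apply: bigmax_le => [|i _]; first by rewrite mulr_ge0// bigmax_ge_id.
    by rewrite ler_wpM2l// (le_bigmax _ (fun i => `|x i 0|)).
  have [->|a0] := eqVneq a 0; first by rewrite normr0 mul0r bigmax_ge_id.
  rewrite mulrC -ler_pdivlMr ?normr_gt0//.
  apply: bigmax_le => [|i _]; first by rewrite divr_ge0// bigmax_ge_id.
  by rewrite ler_pdivlMr ?normr_gt0// mulrC (le_bigmax _ (fun i => `|a| * `|x i 0|)).
have s0 : s != 0 by rewrite gt_eqF// (lt_le_trans ltr01).
under eq_bigr do rewrite mxE normrM powRM//.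
rewrite -mulr_sumr powRM ?powR_ge0 ?sumr_ge0//.
by rewrite -powRrM divff// powRr1.
Qed.

Lemma powR_rnorm s n (x : 'cV[R]_n) : s != 0 ->
  rnorm s%:E x `^ s = \sum_i `|x i 0| `^ s.
Proof.
move=> s0; rewrite /rnorm -powRrM mulVf// powRr1// sumr_ge0//.
Qed.

Lemma powRVK s (a : R) : s != 0 -> 0 <= a -> (a `^ s) `^ s^-1 = a.
Proof. by move=> s0 a0; rewrite -powRrM divff// powRr1. Qed.

Lemma le_rnorm_coord r n (x : 'cV[R]_n) i : (1 <= r)%E -> `|x i 0| <= rnorm r x.
Proof.
move: r; apply: ge1_ereal_ind => [|s s1]; rewrite /rnorm.
  exact: (le_bigmax _ (fun i => `|x i 0|)).
have s0 : s != 0 by rewrite gt_eqF// (lt_le_trans ltr01).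
have si0 : 0 <= s^-1 by rewrite invr_ge0 (le_trans ler01).
rewrite -[leLHS](powRVK s0)//.
rewrite ge0_ler_powR ?nnegrE ?powR_ge0 ?sumr_ge0//.
by rewrite (bigD1 i)//= lerDl sumr_ge0.
Qed.

(** The entries of [x] form a subfamily of those of [y], so for finite exponents the power sum of
    [x] is a partial sum of nonnegative terms. Serves both for dropping a block of coordinates and
    for permuting them. *)
Lemma rnorm_inj r n k (f : 'I_n -> 'I_k) (x : 'cV[R]_n) (y : 'cV[R]_k) :
  (1 <= r)%E -> injective f -> (forall i, x i 0 = y (f i) 0) ->
  rnorm r x <= rnorm r y.
Proof.
move=> + f_inj xy; move: r; apply: ge1_ereal_ind => [|s s1].
  apply: bigmax_le => [|i _]; first exact: bigmax_ge_id.
  by rewrite xy (le_bigmax _ (fun i => `|y i 0|)).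
have s0 : 0 <= s^-1 by rewrite invr_ge0 (le_trans ler01).
rewrite /rnorm ge0_ler_powR ?nnegrE ?sumr_ge0//.
have -> : \sum_i `|x i 0| `^ s = \sum_(j in [set f i | i in 'I_n]%SET) `|y j 0| `^ s.
  rewrite big_imset/=; last by move=> i j _ _; exact: f_inj.
  by apply: eq_big => // i _; rewrite xy.
by rewrite big_mkcond; apply: ler_sum => j _; case: ifP.
Qed.

Lemma rnorm_bij r n k (f : 'I_n -> 'I_k) (x : 'cV[R]_n) (y : 'cV[R]_k) :
  (1 <= r)%E -> bijective f -> (forall i, x i 0 = y (f i) 0) ->
  rnorm r x = rnorm r y.
Proof.
move=> r1 [g fK gK] xy; apply/eqP; rewrite eq_le.
rewrite (rnorm_inj r1 (can_inj fK))//=.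
by rewrite (rnorm_inj r1 (can_inj gK))// => i; rewrite xy gK.
Qed.

(** Comparison with the max norm, whose balls define the topology of column vectors. *)
Lemma rnorm_le_coord r n (x : 'cV[R]_n) e : (1 <= r)%E -> 0 <= e ->
  (forall i, `|x i 0| <= e) -> rnorm r x <= e * rnorm r (const_mx 1 : 'cV[R]_n).
Proof.
move=> r1 e0 xe; rewrite -[X in X * _](ger0_norm e0) -rnormZ//.
by apply: le_rnorm => // i; rewrite !mxE mulr1 (ger0_norm e0).
Qed.

(** Treats an exponent and its conjugate together: the two endpoint pairs need max-norm arguments,
    the interior pairs allow Young's inequality and explicit powers. *)
Lemma hoelder_conjugate_ind (P : \bar R -> \bar R -> Prop) :
  P +oo%E 1%:E -> P 1%:E +oo%E ->
  (forall s q, 0 < s -> 0 < q -> s^-1 + q^-1 = 1 -> P s%:E q%:E) ->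
  forall r, (1 <= r)%E -> P r (hoelder_conjugate r).
Proof.
move=> Py1 P1y Psq; apply: ge1_ereal_ind => [//|s].
rewrite le_eqVlt => /predU1P[<-|s1]; first by rewrite hoelder_conjugate1.
have s0 : 0 < s by rewrite (lt_trans ltr01).
have d0 : 0 < s - 1 by rewrite subr_gt0.
have -> : hoelder_conjugate s%:E = (s / (s - 1))%:E.
  rewrite /hoelder_conjugate/= gt_eqF ?lte_fin// -EFinB inver gt_eqF//.
apply: Psq => //; first by rewrite divr_gt0.
by rewrite invfM invrK mulrBr mulVf ?gt_eqF// mulr1 addrC subrK.
Qed.

Lemma rnorm1 n (x : 'cV[R]_n) : rnorm 1%:E x = \sum_i `|x i 0|.
Proof.
rewrite /rnorm invr1 powRr1 ?sumr_ge0//.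
by under eq_bigr do rewrite powRr1//.
Qed.

Lemma rnorm_eq0 r n (x : 'cV[R]_n) : (1 <= r)%E -> rnorm r x = 0 -> x = 0.
Proof.
move=> r1 x0; apply/matrixP => i j; rewrite (ord1 j) !mxE.
by apply/normr0_eq0/le_anti; rewrite normr_ge0 andbT -x0 le_rnorm_coord.
Qed.

(** At the endpoints one factor is bounded by its largest entry. In the interior case both vectors
    are scaled to norm one and Young's inequality is summed over the coordinates. *)
Lemma hoelder_sum r n (x g : 'cV[R]_n) : (1 <= r)%E ->
  `|\sum_i x i 0 * g i 0| <= rnorm r x * dual_rnorm r g.
Proof.
rewrite /dual_rnorm => r1; apply: (le_trans (ler_norm_sum _ _ _)).
under eq_bigr do rewrite normrM.
move: r r1; apply: (hoelder_conjugate_ind (P := fun r q =>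
  _ <= rnorm r x * rnorm q g)) => [||s q s0 q0 sq].
- rewrite rnorm1 mulr_sumr; apply: ler_sum => i _.
  by rewrite ler_wpM2r// le_rnorm_coord// leey.
- rewrite rnorm1 mulr_suml; apply: ler_sum => i _.
  by rewrite ler_wpM2l// le_rnorm_coord// leey.
have s1 : (1 <= s%:E)%E.
  rewrite lee_fin -[leRHS]invrK invf_ge1 ?invr_gt0// -sq lerDl invr_ge0.
  exact: ltW.
have q1 : (1 <= q%:E)%E.
  rewrite lee_fin -[leRHS]invrK invf_ge1 ?invr_gt0// -sq lerDr invr_ge0.
  exact: ltW.
have [x0|x0] := eqVneq (rnorm s%:E x) 0.
  rewrite x0 mul0r big1// => i _.
  by rewrite (rnorm_eq0 s1 x0) mxE normr0 mul0r.
have [g0|g0] := eqVneq (rnorm q%:E g) 0.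
  rewrite g0 mulr0 big1// => i _.
  by rewrite (rnorm_eq0 q1 g0) mxE normr0 mulr0.
have {}x0 : 0 < rnorm s%:E x by rewrite lt_neqAle eq_sym x0 rnorm_ge0.
have {}g0 : 0 < rnorm q%:E g by rewrite lt_neqAle eq_sym g0 rnorm_ge0.
have xE := powR_rnorm x (lt0r_neq0 s0); have gE := powR_rnorm g (lt0r_neq0 q0).
move: (rnorm s%:E x) (rnorm q%:E g) x0 g0 xE gE => a b x0 g0 xE gE.
suff : (\sum_i `|x i 0| * `|g i 0|) / (a * b) <= 1.
  by rewrite ler_pdivrMr ?mulr_gt0// mul1r.
rewrite mulr_suml -[leRHS]sq.
(* Young's inequality in each coordinate; the two resulting sums equal [s^-1] and [q^-1], because
   the scaled vectors have norm one. *)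
apply: (@le_trans _ _ (\sum_i ((`|x i 0| / a) `^ s / s + (`|g i 0| / b) `^ q / q))).
  apply: ler_sum => i _; rewrite invfM mulrACA.
  by apply: conjugate_powR => //; rewrite divr_ge0// ltW.
rewrite big_split/= lerD//.
  under eq_bigr do rewrite powRM ?invr_ge0 ?(ltW x0)// -mulrA.
  rewrite -mulr_suml -xE mulrA -powRM ?invr_ge0 ?(ltW x0)//.
  by rewrite divff ?gt_eqF// powR1 mul1r.
under eq_bigr do rewrite powRM ?invr_ge0 ?(ltW g0)// -mulrA.
rewrite -mulr_suml -gE mulrA -powRM ?invr_ge0 ?(ltW g0)//.
by rewrite divff ?gt_eqF// powR1 mul1r.
Qed.

(** The extremal [w] is the sign vector of [g] for [r = +oo], a signed unit vector at a largest
    entry of [g] for [r = 1], and is proportional to the signed powers [|g_i|^(q-1)] in between.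
    Asking only for norm at most one lets [w] be 0 when [g] has norm 0. *)
Lemma dual_rnorm_attained r n (g : 'cV[R]_n) : (1 <= r)%E ->
  exists2 w : 'cV[R]_n, rnorm r w <= 1 & \sum_i w i 0 * g i 0 = dual_rnorm r g.
Proof.
rewrite /dual_rnorm; move: r; apply: (hoelder_conjugate_ind (P := fun r q =>
  exists2 w, rnorm r w <= 1 & _ = rnorm q g)) => [||s q s0 q0 sq].
- exists (\col_i Num.sg (g i 0)).
    by apply: bigmax_le => // i _; rewrite mxE normr_sg; case: eqP.
  by rewrite rnorm1; apply: eq_bigr => i _; rewrite mxE -normrEsg.
(* A largest entry exists only in positive dimension. *)
- case: n g => [|n] g.
    exists 0; first by rewrite rnorm1 big_ord0.
    by rewrite /rnorm !big_ord0.
  have [i _ gi] := @eq_bigmax _ R _ 0 ord0 xpredT (fun i => `|g i 0|)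
    isT (fun i _ => normr_ge0 _).
  exists (\col_j if j == i then Num.sg (g i 0) else 0).
    rewrite rnorm1 (bigD1 i)//= big1 ?addr0 => [|j ji].
      by rewrite mxE eqxx normr_sg; case: eqP.
    by rewrite mxE (negbTE ji) normr0.
  rewrite /rnorm gi (bigD1 i)//= big1 ?addr0 => [|j ji].
    by rewrite mxE eqxx -normrEsg.
  by rewrite mxE (negbTE ji) mul0r.
have [g0|g0] := eqVneq (rnorm q%:E g) 0.
  exists 0; last by rewrite g0 big1// => i _; rewrite mxE mul0r.
  rewrite /rnorm big1 ?powR0 ?invr_eq0 ?gt_eqF// => i _.
  by rewrite mxE normr0 powR0// gt_eqF.
have {}g0 : 0 < rnorm q%:E g by rewrite lt_neqAle eq_sym g0 rnorm_ge0.
have gE := powR_rnorm g (lt0r_neq0 q0).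
move: (rnorm q%:E g) g0 gE => b g0 gE.
(* Conjugacy turns the [s]-th powers of the entries of [w] into [q]-th powers of the scaled entries
   of [g], whose sum is one. *)
have qs : (q - 1) * s = q.
  have s1 : s^-1 = (q - 1) / q by rewrite mulrBl divff ?gt_eqF// mul1r -sq addrK.
  apply: (mulIf (x := q^-1)); first by rewrite gt_eqF ?invr_gt0.
  by rewrite mulrAC -s1 mulVf ?divff// gt_eqF.
exists (\col_i (Num.sg (g i 0) * (`|g i 0| / b) `^ (q - 1))).
  rewrite /rnorm.
  rewrite -[leRHS](congr1 (@^~ s^-1) (@powR1 R)) ge0_ler_powR ?nnegrE ?invr_ge0 ?(ltW s0) ?sumr_ge0//.
  apply: (@le_trans _ _ (\sum_i `|g i 0| `^ q / b `^ q)).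
    apply: ler_sum => i _; rewrite mxE normrM normr_sg (ger0_norm (powR_ge0 _ _)).
    have [gi0|gi0] := eqVneq (g i 0) 0.
      by rewrite mul0r powR0 ?gt_eqF// divr_ge0// powR_ge0.
    rewrite mul1r -powRrM qs powRM ?invr_ge0 ?(ltW g0)//.
    by rewrite -powRN -[b^-1]powR_inv1 ?(ltW g0)// -powRrM mulN1r.
  by rewrite -mulr_suml -gE divff// gt_eqF// powR_gt0.
have E i : (\col_i (Num.sg (g i 0) * (`|g i 0| / b) `^ (q - 1))) i 0 * g i 0 =
    `|g i 0| `^ q * (b / b `^ q).
  rewrite mxE mulrAC -normrEsg powRM ?invr_ge0 ?(ltW g0)// [LHS]mulrA.
    rewrite mulr_powRB1//; congr (_ * _).
  rewrite -[b^-1]powR_inv1 ?(ltW g0)// -powRrM mulN1r opprB.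
  by rewrite powRB ?powRr1 ?(ltW g0) ?(gt_eqF g0) ?implybT//.
under eq_bigr do rewrite E.
rewrite -mulr_suml -gE mulrCA divff ?mulr1//.
by rewrite gt_eqF// powR_gt0.
Qed.

End rnorm_theory.

(** * Norms of stacked matrices, of matrix-vector products and of blocks *)

Section stacking.
Context {R : realType}.
Implicit Types (r : \bar R) (n c : nat).

Lemma unstackE n c (xi : 'cV[R]_(n * c)) i j :
  unstack xi i j = xi (mxvec_index i j) 0.
Proof. by rewrite !mxE. Qed.

(** A mixed norm with equal inner and outer exponents collapses: the sum, or maximum, over pairs of
    indices is an iterated one. *)
Lemma rnorm_unstack r n c (xi : 'cV[R]_(n * c)) : (1 <= r)%E ->
  rnorm r xi = rnorm r (\col_i rnorm r (row i (unstack xi))^T).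
Proof.
move=> r1; move: r r1 (r1); apply: ge1_ereal_ind => [|s s1] s1'.
  apply/eqP; rewrite eq_le; apply/andP; split.
    apply: bigmax_le => [|k _]; first exact: rnorm_ge0.
    case/mxvec_indexP: k => i j; rewrite -unstackE.
    have := le_rnorm_coord (\col_i rnorm +oo%E (row i (unstack xi))^T) i s1'.
    rewrite mxE ger0_norm ?rnorm_ge0//; apply: le_trans.
    by have := le_rnorm_coord (row i (unstack xi))^T j s1'; rewrite !mxE.
  apply: bigmax_le => [|i _]; first exact: rnorm_ge0.
  rewrite mxE ger0_norm ?rnorm_ge0//.
  apply: bigmax_le => [|j _]; first exact: rnorm_ge0.
  by rewrite mxE mxE unstackE le_rnorm_coord.
have s0 : s != 0 by rewrite gt_eqF// (lt_le_trans ltr01).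
congr (_ `^ _); rewrite (reindex _ (curry_mxvec_bij _ _)) /=.
rewrite (eq_bigr (fun ij => `|unstack xi ij.1 ij.2| `^ s)); last first.
  by case=> i j _; rewrite unstackE.
rewrite -(pair_bigA _ (fun i j => `|unstack xi i j| `^ s)) /=.
apply: eq_bigr => i _; rewrite [in RHS]mxE [in RHS]ger0_norm ?powR_ge0//.
rewrite powR_rnorm//.
by apply: eq_bigr => j _; rewrite [in RHS]mxE [in RHS]mxE.
Qed.

(** Each entry of the product pairs a row with [g], so Hoelder bounds it by the row norm times the
    dual norm; [rnorm_unstack] then recombines the row norms. *)
Lemma rnorm_unstack_mul r n c (xi : 'cV[R]_(n * c)) (g : 'cV[R]_c) :
  (1 <= r)%E -> rnorm r (unstack xi *m g) <= rnorm r xi * dual_rnorm r g.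
Proof.
move=> r1; rewrite rnorm_unstack// mulrC.
have g0 : 0 <= dual_rnorm r g by exact: rnorm_ge0.
rewrite -[X in X * _](ger0_norm g0) -rnormZ//; apply: le_rnorm => // i.
rewrite mxE [X in _ <= `|X|]mxE normrM (ger0_norm g0) mulrC mxE ger0_norm ?rnorm_ge0//.
apply: le_trans (hoelder_sum _ _ r1); rewrite le_eqVlt; apply/orP; left.
by apply/eqP; congr `| _ |; apply: eq_bigr => j _; rewrite !mxE.
Qed.

Definition stack n c (M : 'M[R]_(n, c)) : 'cV[R]_(n * c) := (mxvec M)^T.

Lemma stackK n c : cancel (@stack n c) (@unstack R n c).
Proof. by move=> M; rewrite /unstack /stack trmxK mxvecK. Qed.

(** Row [i] of the rank one matrix is [d i 0] times [w^T], so the row norms form a multiple of the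
    vector of absolute values of [d]. *)
Lemma rnorm_stack r n c (d : 'cV[R]_n) (w : 'cV[R]_c) : (1 <= r)%E ->
  rnorm r (stack (d *m w^T)) = rnorm r w * rnorm r d.
Proof.
move=> r1; rewrite rnorm_unstack// stackK.
rewrite -[X in X * _](ger0_norm (rnorm_ge0 r w)) -rnormZ//.
apply/le_anti/andP; split; apply: le_rnorm => // i.
all: rewrite !mxE !normrM; have -> : (row i (d *m w^T))^T = d i 0 *: w
  by apply/matrixP => j k; rewrite !mxE big_ord1 mxE (ord1 k).
all: by rewrite rnormZ// normrM normr_id mulrC.
Qed.

Lemma rnorm_usubmx r n k (z : 'cV[R]_(n + k)) : (1 <= r)%E ->
  rnorm r (usubmx z) <= rnorm r z.
Proof. by move=> r1; apply: rnorm_inj (@lshift_inj n k) _ => // i; rewrite mxE. Qed.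

Lemma rnorm_castmx r n k (e : n = k) (z : 'cV[R]_n) :
  rnorm r (castmx (e, erefl 1%N) z) = rnorm r z.
Proof. by case: _ / e. Qed.

Lemma rnorm_col_mxC r n k (x : 'cV[R]_n) (y : 'cV[R]_k) : (1 <= r)%E ->
  rnorm r (col_mx x y) = rnorm r (col_mx y x).
Proof.
pose flip a b (u : 'I_a + 'I_b) : 'I_b + 'I_a :=
  match u with inl j => inr j | inr j => inl j end.
pose swap a b (i : 'I_(a + b)) : 'I_(b + a) := unsplit (flip _ _ (fintype.split i)).
have swapK a b : cancel (swap a b) (swap b a).
  by move=> i; rewrite /swap unsplitK -[RHS]splitK; case: (fintype.split i).
move=> r1; apply: (rnorm_bij (f := swap n k)) => // [|i].
  by exists (swap k n).
rewrite /swap; case: (split_ordP i) => j -> /=.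
  by rewrite col_mxEu col_mxEd.
by rewrite col_mxEu col_mxEd.
Qed.

Lemma castmx_mul n k c q (e : n = k) (M : 'M[R]_(n, c)) (g : 'M[R]_(c, q)) :
  castmx (e, erefl c) M *m g = castmx (e, erefl q) (M *m g).
Proof. by case: _ / e. Qed.

(** Splitting into past and future and exchanging the two blocks only permutes coordinates. *)
Lemma rnorm_future_past r k a b c (M : 'M[R]_(k * (a + b), c)) (g : 'cV[R]_c) :
  (1 <= r)%E ->
  rnorm r (col_mx (future M *m g) (past M *m g)) = rnorm r (M *m g).
Proof.
move=> r1; rewrite rnorm_col_mxC// /future /past mul_dsub_mx mul_usub_mx.
by rewrite vsubmxK castmx_mul rnorm_castmx.
Qed.

End stacking.

(** * Borel measurability of Lipschitz functions, norms and points *)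

Section borel_measurability.
Context {R : realType}.
Implicit Types (r : \bar R) (n : nat).

Lemma continuous_borel_measurable n (F : 'cV[R]_n -> R) : continuous F ->
  measurable_fun [set: borel R n] (F : borel R n -> R).
Proof.
move=> /continuousP cF; apply: (measurability _ (RGenOpens.measurableE R)).
move=> _ [_ [a [b ->]] <-]; rewrite setTI.
by apply: sub_sigma_algebra; apply: cF; exact: interval_open.
Qed.

Lemma lipschitz_rnorm_continuous r n (F : 'cV[R]_n -> R) K : (1 <= r)%E ->
  0 <= K -> (forall y z, `|F y - F z| <= K * rnorm r (y - z)) -> continuous F.
Proof.
move=> r1 K0 FK y; apply/(@cvgrPdist_lt _ _ _ _ (nbhs_filter y)) => e e0.
set C := rnorm r (const_mx 1 : 'cV[R]_n).
have C0 : 0 <= C by exact: rnorm_ge0.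
(* The added 1 keeps the radius well defined when [K * C] is 0. *)
have D0 : 0 < K * C + 1 by rewrite ltr_wpDl// mulr_ge0.
have d0 : 0 < e / (K * C + 1) by rewrite divr_gt0.
apply: filterS (nbhsx_ballx y _ d0) => z [_ yz].
apply: (le_lt_trans (FK _ _)).
apply: (@le_lt_trans _ _ (K * (e / (K * C + 1) * C))).
  rewrite ler_wpM2l// rnorm_le_coord ?(ltW d0)// => i.
  by rewrite !mxE; have := yz i 0; rewrite /ball/= => /ltW.
rewrite [ltLHS](_ : _ = e * ((K * C) / (K * C + 1))); last by ring.
by rewrite gtr_pMr// ltr_pdivrMr// mul1r ltrDl.
Qed.

Lemma measurable_coord n (i : 'I_n) :
  measurable_fun [set: borel R n] (fun x : borel R n => (x : 'cV[R]_n) i 0).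
Proof. by apply: continuous_borel_measurable; exact: coord_continuous. Qed.

(** Measurability goes through the coordinates so that it also covers the product of two Borel
    spaces, on which couplings live. *)
Lemma measurable_rnorm d (T : measurableType d) r n (X : T -> 'cV[R]_n) :
  (1 <= r)%E -> (forall i, measurable_fun setT (fun t => X t i 0)) ->
  measurable_fun setT (fun t => rnorm r (X t)).
Proof.
move=> + mX; have mXn i : measurable_fun setT (fun t => `|X t i 0|).
  exact: measurableT_comp.
move: r; apply: ge1_ereal_ind => [|s s1]; rewrite /rnorm.
  rewrite [X in measurable_fun _ X](_ : _ =
    fun t => \big[Num.max/0]_(i <- index_enum 'I_n) `|X t i 0|)//.
  elim: (index_enum 'I_n) => [|i l ih].
    rewrite [X in measurable_fun _ X](_ : _ = cst 0); first exact: measurable_cst.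
    by apply/funext => t; rewrite big_nil.
  rewrite [X in measurable_fun _ X](_ : _ = (fun t => `|X t i 0|) \max
    (fun t => \big[Num.max/0]_(i <- l) `|X t i 0|)); first exact: measurable_maxr.
  by apply/funext => t; rewrite big_cons.
apply: (measurableT_comp (measurable_powR _)); apply: measurable_sum => i.
exact: (measurableT_comp (measurable_powR _)).
Qed.

Lemma measurable_dist r n : (1 <= r)%E ->
  measurable_fun [set: borel R n * borel R n]
    (fun z : borel R n * borel R n =>
       rnorm r ((z.1 : 'cV[R]_n) - (z.2 : 'cV[R]_n))).
Proof.
move=> r1; apply: measurable_rnorm => // i.
under eq_fun do rewrite !mxE.
apply: measurable_funB.
  exact: (measurableT_comp (measurable_coord i) measurable_fst).
exact: (measurableT_comp (measurable_coord i) measurable_snd).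
Qed.

(** A point is the zero set of the measurable distance to it. *)
Lemma measurable_point n (x : 'cV[R]_n) : measurable ([set x] : set (borel R n)).
Proof.
have mF : measurable_fun [set: borel R n]
    (fun y : borel R n => rnorm 1%:E ((y : 'cV[R]_n) - x)).
  apply: measurable_rnorm => // i; under eq_fun do rewrite !mxE.
  by apply: measurable_funB => //; exact: measurable_coord.
rewrite (_ : [set x] = setT `&` (fun y : borel R n =>
    rnorm 1%:E ((y : 'cV[R]_n) - x)) @^-1` [set 0]).
  by apply: mF => //; exact: measurable_set1.
rewrite setTI; apply/seteqP; split => [y ->|y yx].
  change (rnorm 1%:E (x - x) = 0).
  by rewrite subrr rnorm1 big1// => i _; rewrite mxE normr0.
have /(rnorm_eq0 (lexx _)) {}yx : rnorm 1%:E ((y : 'cV[R]_n) - x) = 0 by exact: yx.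
by apply/eqP; rewrite -subr_eq0 yx.
Qed.

End borel_measurability.

(** * Integrals over arbitrary sets and finitely supported probabilities *)

Section discrete.
Context {R : realType} d (T : measurableType d).
Local Open Scope ereal_scope.

(* The support set [Xi] need not be measurable, so that integrals over
   [Xi `*` Xi] are only suprema of integrals of simple functions. *)
Lemma ge0_subset_integral_nonmeasurable (mu : {measure set T -> \bar R})
    (A B : set T) (f : T -> \bar R) : (forall x, 0 <= f x) -> A `<=` B ->
  \int[mu]_(x in A) f x <= \int[mu]_(x in B) f x.
Proof.
move=> f0 AB; rewrite integral_mkcond [leRHS]integral_mkcond.
rewrite !ge0_integralTE; try by move=> x; rewrite /patch; case: ifP.
apply: ge_ereal_sup => _ [h hA <-]; apply: ereal_sup_ubound.
exists h => // x; apply: (le_trans (hA x)); rewrite /patch.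
by case: ifPn => [/set_mem/AB/mem_set -> //|_]; case: ifP.
Qed.

(** Serves for the empirical law, for the perturbed laws and for the couplings between them. *)
Lemma discrete_probability (I : finType) (w : I -> R) (x : I -> T) :
  (forall i, (0 <= w i)%R) -> (\sum_i w i)%R = 1%R ->
  exists P : probability T R,
    (forall A, P A = \sum_i (w i)%:E * \d_(x i) A) /\
    forall f : T -> \bar R, measurable_fun setT f -> (forall t, 0 <= f t) ->
      \int[P]_t f t = \sum_i (w i)%:E * f (x i).
Proof.
move=> w0 w1.
(* [msum] takes a sequence of measures, so [I] is enumerated; indices from [#|I|] on receive the
   zero measure. *)
pose m_ (k : nat) : {measure set T -> \bar R} :=
  if (insub k : option 'I_#|I|) is Some i
  then mscale (NngNum (w0 (enum_val i))) \d_(x (enum_val i)) else mzero.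
pose m := msum m_ #|I|.
have sumE (G : I -> \bar R) (H : nat -> \bar R) :
    (forall i : 'I_#|I|, H i = G (enum_val i)) ->
    \sum_(k < #|I|) H k = \sum_i G i.
  move=> HG; rewrite [RHS](reindex (fun i : 'I_#|I| => enum_val i)) /=.
    by apply: eq_bigr => i _; rewrite HG.
  by exists enum_rank => i _; [exact: enum_valK|exact: enum_rankK].
have mE A : m A = \sum_i (w i)%:E * \d_(x i) A.
  rewrite -[RHS](sumE _ (fun k => m_ k A))// => i.
  by rewrite /m_ valK.
have mT : m setT = 1.
  rewrite mE; under eq_bigr do rewrite diracT mule1.
  by rewrite sumEFin w1.
pose mP := Measure_isProbability.Build _ _ _ m mT.
pose P : probability T R := HB.pack m mP.
exists P; split => // f mf f0.
rewrite [LHS](_ : _ = \int[m]_t f t)//.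
rewrite ge0_integral_measure_sum//.
rewrite -[RHS](sumE _ (fun k => \int[m_ k]_t f t))// => i.
by rewrite /m_ valK ge0_integral_mscale// integral_dirac// diracT mul1e.
Qed.

End discrete.

(** * Upper bound for expectations over the Wasserstein ball *)

Section wasserstein_bounds.
Context {R : realType}.
Implicit Types (r : \bar R) (n N : nat).
Local Open Scope ereal_scope.

(** The marginals are the push-forwards under the projections, so this is a change of variables. *)
Lemma coupling_integral n (P Q : {measure set (borel R n) -> \bar R})
    (Pi : probability (borel R n * borel R n)%type R) (f : borel R n -> \bar R) :
  coupling P Q Pi -> measurable_fun setT f -> (forall x, 0 <= f x) ->
  \int[Pi]_z f z.1 = \int[P]_x f x /\ \int[Pi]_z f z.2 = \int[Q]_x f x.
Proof.
move=> PiPQ mf f0; split.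
- transitivity (\int[pushforward Pi (@fst (borel R n) (borel R n))]_x f x).
    by rewrite (ge0_integral_pushforward measurable_fst).
  apply: eq_measure_integral => A mA _; rewrite -(PiPQ A mA).1 /pushforward.
  by congr (Pi _); apply/seteqP; split => [z|z []].
- transitivity (\int[pushforward Pi (@snd (borel R n) (borel R n))]_x f x).
    by rewrite (ge0_integral_pushforward measurable_snd).
  apply: eq_measure_integral => A mA _; rewrite -(PiPQ A mA).2 /pushforward.
  by congr (Pi _); apply/seteqP; split => [z|z []].
Qed.

Lemma empiricalE n N (x : 'I_N -> 'cV[R]_n) A :
  empirical x A = \sum_i (N%:R^-1)%:E * \d_(x i : borel R n) A.
Proof. by rewrite /empirical ge0_sume_distrr. Qed.

Lemma empirical_integral n N (x : 'I_N -> 'cV[R]_n) (F : borel R n -> R) :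
  (0 < N)%N -> measurable_fun setT F -> (forall y, (0 <= F y)%R) ->
  \int[empirical x]_y (F y)%:E = (N%:R^-1 * (\sum_i F (x i)))%:E.
Proof.
move=> N0 mF F0.
have w0 (i : 'I_N) : (0 <= N%:R^-1 :> R)%R by rewrite invr_ge0.
have w1 : (\sum_(i < N) N%:R^-1 = 1 :> R)%R.
  by rewrite sumr_const card_ord -[LHS]mulr_natr mulVf// pnatr_eq0 -lt0n.
have [P [PE Pint]] := discrete_probability (x : 'I_N -> borel R n) w0 w1.
rewrite (eq_measure_integral P) => [|A _ _]; last first.
  by rewrite [LHS]empiricalE; exact/esym/PE.
rewrite Pint//; last exact/measurable_EFinP.
by rewrite mulr_sumr -sumEFin; apply: eq_bigr => i _; rewrite EFinM.
Qed.

Lemma wball_expectation_le n N (x : 'I_N -> 'cV[R]_n) (Xi : set 'cV[R]_n) r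
    (eps K : R) (F : 'cV[R]_n -> R) (Q : probability (borel R n) R) :
  (0 < N)%N -> 1 <= r -> (forall i, Xi (x i)) -> (0 <= K)%R ->
  (forall y, (0 <= F y)%R) ->
  (forall y z, (`|F y - F z| <= K * rnorm r (y - z))%R) ->
  wball Xi r eps (empirical x) Q ->
  'E_Q[F] <= (N%:R^-1 * (\sum_i F (x i)) + K * eps)%:E.
Proof.
move=> N0 r1 Xx K0 F0 FK [[[B [mB QB XiB] _]] QW].
have mF : measurable_fun [set: borel R n] (F : borel R n -> R).
  by apply: continuous_borel_measurable; exact: lipschitz_rnorm_continuous FK.
have mEF : measurable_fun [set: borel R n] (EFin \o F) by exact/measurable_EFinP.
pose dist (z : borel R n * borel R n) : R :=
  rnorm r ((z.1 : 'cV[R]_n) - (z.2 : 'cV[R]_n))%R.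
have mdist : measurable_fun setT (EFin \o dist).
  by apply/measurable_EFinP; exact: measurable_dist.
have dist0 z : 0 <= (dist z)%:E by rewrite lee_fin; exact: rnorm_ge0.
rewrite unlock; apply/lee_addgt0Pr => e e0.
(* The coupling exceeds the optimal cost by less than [e / (K + 1)], which after multiplication by
   [K] stays below [e] even for [K = 0]. *)
have K1 : (0 < K + 1)%R by rewrite ltr_wpDl.
have [_ [Pi PiC <-]] : exists2 c,
    [set \int[Pi]_(z in Xi `*` Xi) (dist z)%:E | Pi in coupling (empirical x) Q] c
    & c < (eps + e / (K + 1))%:E.
  apply: ereal_inf_lt; apply: (le_lt_trans QW).
  by rewrite lte_fin ltrDl divr_gt0.
move=> PiW.
have [PiF1 PiF2] := coupling_integral PiC mEF (fun y => F0 y).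
rewrite -PiF2.
apply: (@le_trans _ _ (\int[Pi]_z ((F z.1)%:E + K%:E * (dist z)%:E))).
  apply: ge0_le_integral => //.
  - by move=> z _; rewrite lee_fin.
  - exact: (measurableT_comp mEF measurable_snd).
  - apply: emeasurable_funD; first exact: (measurableT_comp mEF measurable_fst).
    exact: measurable_funeM.
  - move=> z _; rewrite -EFinM -EFinD lee_fin -lerBlDl.
    apply: (le_trans (ler_norm _)); rewrite distrC; exact: FK.
rewrite ge0_integralD//; last 4 first.
- by move=> z _; rewrite lee_fin.
- exact: (measurableT_comp mEF measurable_fst).
- by move=> z _; rewrite mule_ge0// lee_fin.
- exact: measurable_funeM.
rewrite PiF1 (empirical_integral _ N0 mF F0) ge0_integralZl//.
rewrite !EFinD -addeA; apply: leeD2l.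
(* Transport cost is only integrated over [Xi]*[Xi], but nothing is lost. The first marginal lives
   on the finite set [C] of samples inside [Xi], and the second avoids the null set [B] containing
   the complement of [Xi]. Both sets are measurable, whatever [Xi] is. *)
have PiW' : \int[Pi]_z (dist z)%:E <= \int[Pi]_(z in Xi `*` Xi) (dist z)%:E.
  pose C : set (borel R n) := \bigcup_(i in [set: 'I_N]) [set x i].
  have mC : measurable C by apply: fin_bigcup_measurable => // i _; exact: measurable_point.
  have CXi : C `<=` Xi.
    by move=> y [i _ ->].
  pose N1 : set (borel R n * borel R n) := ~` C `*` setT.
  pose N2 : set (borel R n * borel R n) := setT `*` B.
  have mN : measurable (N1 `|` N2).
    apply: measurableU; apply: measurableX => //; exact: measurableC.
  have PiN : Pi (N1 `|` N2) = 0.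
    have Pi1 : Pi N1 = 0.
      rewrite [LHS](PiC _ (measurableC mC)).1 [LHS]empiricalE big1// => i _.
      by rewrite diracE memNset ?mule0//= => /(_ _); apply; exists i.
    have Pi2 : Pi N2 = 0 by rewrite [LHS](PiC _ mB).2.
    have : Pi N1 + Pi N2 <= 0 by rewrite Pi1 Pi2 adde0.
    move=> N12; apply/eqP; rewrite eq_le measure_ge0 andbT.
    apply: le_trans N12; apply: measureU2; last exact: measurableX.
    by apply: measurableX => //; exact: measurableC.
  rewrite (ge0_negligible_integral mN measurableT _ _ PiN)//.
  apply: ge0_subset_integral_nonmeasurable => //.
  move=> z [_ /not_orP[zC zB]]; split.
    by apply: CXi; apply: contrapT => nC; apply: zC.
  by apply: contrapT => nXi; apply: zB; split => //; exact: XiB.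
have K0' : 0 <= K%:E by rewrite lee_fin.
apply: (le_trans (lee_wpmul2l K0' (le_trans PiW' (ltW PiW)))).
rewrite -EFinM -EFinD lee_fin mulrDr lerD2l mulrCA ler_piMr ?(ltW e0)//.
by rewrite ler_pdivrMr// mul1r lerDl.
Qed.

End wasserstein_bounds.

(** * Growth of convex functions along rays and perturbed empirical laws *)

Section worst_case.
Context {R : realType}.
Implicit Types (r : \bar R) (n N : nat).

Lemma convex_function_le n (f : 'cV[R]_n -> R) t x y :
  convex_function setT f -> 0 <= t <= 1 ->
  f (t *: x + (1 - t) *: y) <= t * f x + (1 - t) * f y.
Proof.
move=> cf /andP[t0 t1].
by have := cf (Itv01 t0 t1) x y (in_setT _) (in_setT _); rewrite convRE.
Qed.

(** [x] is the convex combination of [y + t *: (x - y)] and [y] with weight [t^-1] on the former, so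
    the slope of a chord persists beyond its endpoint. *)
Lemma convex_ray n (f : 'cV[R]_n -> R) t x y :
  (forall s x y, 0 <= s <= 1 ->
     f (s *: x + (1 - s) *: y) <= s * f x + (1 - s) * f y) ->
  1 <= t -> t * (f x - f y) <= f (y + t *: (x - y)) - f y.
Proof.
move=> cf t1; have t0 : 0 < t by rewrite (lt_le_trans ltr01).
have t01 : 0 <= t^-1 <= 1 by rewrite invr_ge0 (ltW t0) invf_le1.
have := cf t^-1 (y + t *: (x - y)) y t01.
have -> : t^-1 *: (y + t *: (x - y)) + (1 - t^-1) *: y = x.
  rewrite scalerDr scalerA mulVf ?gt_eqF// scale1r scalerBl scale1r addrC.
  by rewrite addrA subrK addrCA subrr addr0.
move=> fx; rewrite -ler_pdivlMl//; apply: (@le_trans _ _ (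
  t^-1 * f (y + t *: (x - y)) + (1 - t^-1) * f y - f y)); first by rewrite lerB.
by rewrite le_eqVlt; apply/orP; left; apply/eqP; ring.
Qed.

Local Open Scope ereal_scope.

(* Every atom sends the fraction [th] of its mass from [x i] to [x i + v]. *)
Lemma wball_partial_shift n N (x : 'I_N -> 'cV[R]_n) r (eps th : R)
    (v : 'cV[R]_n) :
  (0 < N)%N -> 1 <= r -> (0 <= th <= 1)%R -> (th * rnorm r v <= eps)%R ->
  exists2 Q, wball setT r eps (empirical x) Q &
    forall F : 'cV[R]_n -> R, measurable_fun setT (F : borel R n -> R) ->
      (forall y, (0 <= F y)%R) ->
      'E_Q[F] = (N%:R^-1 * (\sum_i ((1 - th) * F (x i) + th * F (x i + v))))%:E.
Proof.
move=> N0 r1 /andP[th0 th1] thv.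
have N0' : (N%:R != 0 :> R)%R by rewrite pnatr_eq0 -lt0n.
(* Each sample is split in two atoms; the boolean is true on the displaced one. *)
pose I := ('I_N * bool)%type.
pose w (i : I) : R := (N%:R^-1 * (if i.2 then th else 1 - th))%R.
have w0 i : (0 <= w i)%R.
  by rewrite /w mulr_ge0 ?invr_ge0//; case: i.2; rewrite ?subr_ge0.
have sumI (G : I -> R) : (\sum_i w i * G i)%R =
    (N%:R^-1 * \sum_i ((1 - th) * G (i, false) + th * G (i, true)))%R.
  rewrite (eq_bigr (fun i => w (i.1, i.2) * G (i.1, i.2))%R); last by case.
  rewrite -(pair_bigA _ (fun i b => w (i, b) * G (i, b))%R)/= mulr_sumr.
  apply: eq_bigr => i _; rewrite big_bool /w/=; ring.
have w1 : (\sum_i w i = 1)%R.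
  under eq_bigr do rewrite -[w _]mulr1.
  rewrite (sumI (fun=> 1%R)); under eq_bigr do rewrite -mulrDl subrK mulr1.
  by rewrite sumr_const card_ord -[X in (_ * X)%R]mulr_natr mul1r mulVf.
pose y (i : I) : 'cV[R]_n := if i.2 then (x i.1 + v)%R else x i.1.
have [Q [QE Qint]] := discrete_probability (y : I -> borel R n) w0 w1.
(* The coupling pairs each atom with its new position, at total cost [th * rnorm r v]. *)
have [Pi [PiE Piint]] := discrete_probability
  (fun i : I => (x i.1 : borel R n, y i : borel R n)) w0 w1.
have EQ (F : 'cV[R]_n -> R) : measurable_fun setT (F : borel R n -> R) ->
    (forall y, (0 <= F y)%R) -> 'E_Q[F] =
      (N%:R^-1 * (\sum_i ((1 - th) * F (x i) + th * F (x i + v))))%:E.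
  move=> mF F0; rewrite unlock Qint//; last exact/measurable_EFinP.
  under eq_bigr do rewrite -EFinM.
  by rewrite sumEFin (sumI (F \o y)).
exists Q => //; split; first split.
- exact: aeW.
- rewrite EQ ?ltry//.
    by apply: measurable_rnorm => // i; exact: measurable_coord.
  by move=> z; exact: rnorm_ge0.
have PiC : coupling (empirical x) Q Pi.
  move=> A mA; split.
    rewrite PiE [RHS]empiricalE.
    rewrite (eq_bigr (fun i => (w (i.1, i.2))%:E * \d_(x i.1 : borel R n) A)); last first.
      case=> i b _ /=; congr (_ * _); rewrite !diracE; congr ((nat_of_bool _)%:R%:E).
      by apply/idP/idP; rewrite !inE/= => // -[].
    rewrite -(pair_bigA _ (fun i b => (w (i, b))%:E * \d_(x i : borel R n) A))/=.
    apply: eq_bigr => i _; rewrite big_bool /= -ge0_muleDl ?lee_fin//.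
    by rewrite -EFinD /w/= -mulrDr addrC subrK mulr1.
  rewrite PiE [RHS]QE; apply: eq_bigr => i _; congr (_ * _).
  rewrite !diracE; congr ((nat_of_bool _)%:R%:E).
  by apply/idP/idP; rewrite !inE/= => // -[].
apply: (@le_trans _ _ (\int[Pi]_(z in setT `*` setT)
    (rnorm r ((z.1 : 'cV[R]_n) - (z.2 : 'cV[R]_n))%R)%:E)).
  by apply: ereal_inf_lbound; exists Pi.
rewrite setXTT Piint; first last.
- by move=> z; rewrite lee_fin; exact: rnorm_ge0.
- by apply/measurable_EFinP; exact: measurable_dist.
under eq_bigr do rewrite -EFinM.
rewrite sumEFin (sumI (fun i => rnorm r (x i.1 - y i)%R)) lee_fin /y/=.
apply: (le_trans _ thv).
rewrite (eq_bigr (fun=> th * rnorm r v)%R).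
  by rewrite sumr_const card_ord -[X in (_ * X)%R]mulr_natl mulKf//.
move=> i _; rewrite subrr -(scale0r v) rnormZ// normr0 mul0r mulr0 add0r.
by rewrite opprD addrA subrr add0r -scaleN1r rnormZ// normrN1 mul1r.
Qed.

End worst_case.

(** * Sharpness of the upper bound on the whole space *)

Section attainment.
Context {R : realType}.
Implicit Types (r : \bar R) (n N : nat).

Lemma rnormN r n (x : 'cV[R]_n) : (1 <= r)%E -> rnorm r (- x) = rnorm r x.
Proof. by move=> r1; rewrite -scaleN1r rnormZ// normrN1 mul1r. Qed.

(** Otherwise [K] would itself be a Lipschitz bound, against minimality of [L]; exchanging [x] and
    [y] removes the absolute value. *)
Lemma lipschitz_constant_gap r n (f : 'cV[R]_n -> R) L K : (1 <= r)%E ->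
  lipschitz_constant r f L -> 0 <= K -> K < L ->
  exists x y, K * rnorm r (x - y) < f x - f y.
Proof.
move=> r1 [_ Lmin] K0 KL; apply: contrapT => nxy.
suff /Lmin : lipschitz_bound r f K by rewrite leNgt KL.
split => // x y; rewrite leNgt; apply/negP => xy; apply: nxy.
have [fxy|fxy] := lerP 0 (f x - f y).
  by exists x, y; rewrite -[ltRHS](ger0_norm fxy).
by exists y, x; rewrite -[y - x]opprB rnormN// -[ltRHS]opprB -(ltr0_norm fxy).
Qed.

(** [Z] abstracts the map from data to outputs, and [V d] a data perturbation no longer than [d]
    that moves the outputs along [d] with gain [G]. The loss [e] is there because neither the slope
    [L] nor the limit [th = 0] need be attained. *)
Lemma wball_expectation_ge n k N (x : 'I_N -> 'cV[R]_n) r (eps L G e : R)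
    (ell : 'cV[R]_k -> R) (Z : 'cV[R]_n -> 'cV[R]_k) (V : 'cV[R]_k -> 'cV[R]_n) :
  (0 < N)%N -> (1 <= r)%E -> 0 <= eps -> 0 < L -> 0 <= G -> 0 < e ->
  (forall s x y, 0 <= s <= 1 ->
     ell (s *: x + (1 - s) *: y) <= s * ell x + (1 - s) * ell y) ->
  lipschitz_constant r ell L -> (forall z, 0 <= ell z) ->
  (forall xi xi', rnorm r (Z xi - Z xi') <= G * rnorm r (xi - xi')) ->
  (forall d, rnorm r (V d) <= rnorm r d) ->
  (forall xi s d, Z (xi + s *: V d) = Z xi + (s * G) *: d) ->
  exists2 Q, wball setT r eps (empirical x) Q &
    ((N%:R^-1 * (\sum_i ell (Z (x i))) + L * eps * G - e)%:E
      <= 'E_Q[ell \o Z])%E.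
Proof.
move=> N0 r1 eps0 L0 G0 e0 cell ellL ell0 ZG VG ZV.
have N0' : 0 < N%:R :> R by rewrite ltr0n.
have LG0 : 0 <= L * G by rewrite mulr_ge0// ltW.
have mF : measurable_fun setT ((ell \o Z) : borel R n -> R).
  apply: continuous_borel_measurable; apply: (lipschitz_rnorm_continuous r1 LG0).
  move=> y z; apply: (le_trans (ellL.1.2 _ _)).
  by rewrite -mulrA ler_wpM2l ?(ltW L0).
(* Here the term [L * eps * G] vanishes and the unmoved atoms suffice. *)
have [epsG0|epsG0] := eqVneq (eps * G) 0.
  have [||Q QB QE] := @wball_partial_shift _ _ _ x r eps 0 0 N0 r1.
  - by rewrite lexx ler01.
  - by rewrite mul0r.
  exists Q => //; rewrite (QE _ mF (fun y => ell0 _)) lee_fin -mulrA epsG0 mulr0 addr0 subr0.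
  under [in leRHS]eq_bigr do rewrite mul1r mul0r addr0.
  by rewrite gerBl ltW.
have {}epsG0 : 0 < eps * G by rewrite lt_neqAle eq_sym epsG0 mulr_ge0.
(* Replacing the slope [L] by [K] costs at most [e / 2] once multiplied by [eps * G]; the maximum
   keeps [K] an admissible Lipschitz bound. *)
pose K := Num.max 0 (L - e / (2 * (eps * G))).
have K0 : 0 <= K by rewrite le_max lexx.
have eK : 0 < e / (2 * (eps * G)) by rewrite divr_gt0// mulr_gt0.
have KL : K < L by rewrite gt_max L0 gtrBl.
have [a [b ab]] := lipschitz_constant_gap r1 ellL K0 KL.
set d := a - b in ab; set D := rnorm r d in ab.
have ell_lt : 0 < ell a - ell b by apply: le_lt_trans ab; rewrite mulr_ge0// rnorm_ge0.
have D0 : 0 < D.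
  rewrite -(pmulr_rgt0 _ L0); apply: (lt_le_trans ell_lt).
  by apply: (le_trans (ler_norm _)); exact: ellL.1.2.
(* Bounds, uniformly in the sample, the error of starting the ray at [Z (x i)] instead of [b]. *)
pose c := \sum_i 2 * (L * rnorm r (Z (x i) - b)).
have c0 i : 0 <= 2 * (L * rnorm r (Z (x i) - b)).
  by rewrite mulr_ge0// mulr_ge0 ?rnorm_ge0// ltW.
have c_ge0 : 0 <= c by rewrite sumr_ge0.
(* [th <= eps * G / D] makes the displacement at least [a - b], so that
   [convex_ray] applies; the last bound keeps the loss [th * c] below [e / 2]. *)
pose th := Num.min 1 (Num.min (eps * G / D) (e / (2 * (c + 1)))).
have c1 : 0 < c + 1 by rewrite ltr_wpDl.
have th0 : 0 < th.
  by rewrite !lt_min ltr01 !divr_gt0// mulr_gt0.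
have th1 : th <= 1 by rewrite ge_min lexx.
(* With this length, mass [th] moved by at most [s * D] costs at most [eps]. *)
pose s := eps / (th * D).
have s0 : 0 <= s by rewrite divr_ge0// mulr_ge0// ltW.
have [||Q QB QE] := @wball_partial_shift _ _ _ x r eps th (s *: V d) N0 r1.
- by rewrite (ltW th0).
- rewrite rnormZ// (ger0_norm s0) mulrA.
  apply: (@le_trans _ _ (th * s * D)).
    by rewrite ler_wpM2l// mulr_ge0// ltW.
  by rewrite [leLHS](_ : _ = eps)// /s; field; rewrite !gt_eqF.
exists Q => //; rewrite (QE _ mF (fun y => ell0 _)) lee_fin.
pose t := s * G.
have tE : th * (t * D) = eps * G.
  by rewrite /t /s; field; rewrite !gt_eqF.
have t1 : 1 <= t.
  rewrite /t /s mulrAC ler_pdivlMr ?mulr_gt0// mul1r -ler_pdivlMr//.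
  by rewrite !ge_min lexx orbT.
(* The ray from [b] gains at least [t * (K * D)]; its two ends are compared with those of the
   parallel ray from [Z (x i)] by the Lipschitz bound. *)
have step i : t * (K * D) - c <= ell (Z (x i + s *: V d)) - ell (Z (x i)).
  rewrite ZV -/t.
  have h1 := convex_ray a b cell t1.
  have h2 : t * (K * D) <= t * (ell a - ell b).
    by rewrite ler_wpM2l ?(ltW ab)// (le_trans ler01).
  have h3 : ell (b + t *: d) - ell (Z (x i) + t *: d) <= L * rnorm r (Z (x i) - b).
    apply: (le_trans (ler_norm _)); rewrite distrC.
    apply: (le_trans (ellL.1.2 _ _)).
    by rewrite opprD addrACA subrr addr0.
  have h4 : ell (Z (x i)) - ell b <= L * rnorm r (Z (x i) - b).
    by apply: (le_trans (ler_norm _)); exact: ellL.1.2.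
  have h5 : 2 * (L * rnorm r (Z (x i) - b)) <= c.
    by rewrite /c (bigD1 i)//= lerDl sumr_ge0.
  move: h1 h2 h3 h4 h5; rewrite -/d; lra.
(* By [tE] the average gain is [eps * G * K - th * c], and each of the two losses is at most
   [e / 2]. *)
apply: (@le_trans _ _ (N%:R^-1 * \sum_(i < N) (ell (Z (x i)) + th * (t * (K * D) - c)))).
  rewrite big_split/= sumr_const card_ord -[(th * _) *+ N]mulr_natl mulrDr mulKf ?gt_eqF//.
  rewrite -addrA lerD2l mulrBr.
  have -> : th * (t * (K * D)) = eps * G * K by rewrite -tE; ring.
  have h1 : th * c <= e / 2.
    apply: (@le_trans _ _ (th * (c + 1))); first by rewrite ler_wpM2l ?(ltW th0)// lerDl.
    rewrite -ler_pdivlMr// -mulrA -invfM.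
    by rewrite !ge_min lexx !orbT.
  have h2 : eps * G * (L - e / (2 * (eps * G))) <= eps * G * K.
    by rewrite ler_wpM2l ?(ltW epsG0)// le_max lexx orbT.
  have h3 : eps * G * (L - e / (2 * (eps * G))) = L * eps * G - e / 2.
    have -> : L * eps * G = eps * G * L by ring.
    have en0 : (eps != 0) && (G != 0) by rewrite -negb_or -mulf_eq0 gt_eqF.
    by field; rewrite andbC.
  rewrite h3 in h2; lra.
rewrite ler_wpM2l ?invr_ge0// ler_sum// => i _.
have := ler_wpM2l (ltW th0) (step i); rewrite /comp; lra.
Qed.

End attainment.

(** * Outputs as an affine function of the data and their rank one perturbations *)

Section data_matrices.
Context {R : realType} {p Tini Tf c : nat}.
Local Notation dim := (p * (Tini + Tf) * c)%N.
Implicit Types (g : 'cV[R]_c) (yini : 'cV[R]_(p * Tini)) (xi : 'cV[R]_dim).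

Lemma Yf_linear a xi xi' : Yf (a *: xi + xi') = a *: Yf xi + Yf xi'.
Proof. by apply/matrixP => i j; rewrite !mxE !castmxE !mxE. Qed.

Lemma Yp_linear a xi xi' : Yp (a *: xi + xi') = a *: Yp xi + Yp xi'.
Proof. by apply/matrixP => i j; rewrite !mxE !castmxE !mxE. Qed.

Definition outputs g yini xi : 'cV[R]_(p * Tf + p * Tini) :=
  col_mx (Yf xi *m g) (Yp xi *m g - yini).

(** The offset [yini] cancels, leaving the two blocks of the matrix of [xi - xi'] applied to [g]. *)
Lemma rnorm_outputsB r g yini xi xi' : (1 <= r)%E ->
  rnorm r (outputs g yini xi - outputs g yini xi')
    <= dual_rnorm r g * rnorm r (xi - xi').
Proof.
move=> r1; have -> : outputs g yini xi - outputs g yini xi' =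
    col_mx (Yf (xi - xi') *m g) (Yp (xi - xi') *m g).
  rewrite /outputs opp_col_mx add_col_mx opprB addrA subrK.
  rewrite [xi - xi']addrC -[- xi']scaleN1r Yf_linear Yp_linear !mulmxDl !scaleN1r.
  by rewrite !mulNmx [- (Yf _ *m _) + _]addrC [- (Yp _ *m _) + _]addrC.
by rewrite rnorm_future_past// mulrC rnorm_unstack_mul.
Qed.

(* Data matrices carry the past outputs on top, the arguments of the cost carry
   the future ones on top. *)
Definition assemble (d : 'cV[R]_(p * Tf + p * Tini)) : 'cV[R]_(p * (Tini + Tf)) :=
  castmx (esym (mulnDr p Tini Tf), erefl 1%N) (col_mx (dsubmx d) (usubmx d)).

Lemma rnorm_assemble r d : (1 <= r)%E -> rnorm r (assemble d) = rnorm r d.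
Proof. by move=> r1; rewrite rnorm_castmx rnorm_col_mxC// vsubmxK. Qed.

Lemma Yf_rank1 d (w : 'cV[R]_c) :
  Yf (stack (assemble d *m w^T)) = usubmx d *m w^T.
Proof.
rewrite /Yf stackK /future -castmx_mul castmx_comp castmx_id.
by rewrite -mul_dsub_mx col_mxKd.
Qed.

Lemma Yp_rank1 d (w : 'cV[R]_c) :
  Yp (stack (assemble d *m w^T)) = dsubmx d *m w^T.
Proof.
rewrite /Yp stackK /past -castmx_mul castmx_comp castmx_id.
by rewrite -mul_usub_mx col_mxKu.
Qed.

(** A rank one matrix [d w^T] sends [g] to [d] times the scalar product of [w] and [g], in each
    block. *)
Lemma outputs_rank1 g yini xi s d (w : 'cV[R]_c) G :
  \sum_i w i 0 * g i 0 = G ->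
  outputs g yini (xi + s *: stack (assemble d *m w^T)) =
  outputs g yini xi + (s * G) *: d.
Proof.
move=> wg; have wgE : w^T *m g = G%:M.
  apply/matrixP => i j; rewrite !ord1 !mxE eqxx mulr1n -wg.
  by apply: eq_bigr => k _; rewrite mxE.
rewrite /outputs addrC Yf_linear Yp_linear Yf_rank1 Yp_rank1 !mulmxDl.
rewrite -!scalemxAl -!mulmxA wgE !mul_mx_scalar !scalerA.
rewrite -[d in RHS]vsubmxK scale_col_mx add_col_mx.
by congr col_mx; [rewrite addrC|rewrite -addrA addrC].
Qed.

End data_matrices.

(** * The conditional value at risk over the Wasserstein ball *)

Section risk.
Context {R : realType}.

(** The [tau] of (T) is the negative of the one in the CVaR. The [s i] dominate the positive parts
    at the samples, so the feasibility inequality divided by [alpha] bounds the value at [- tau]. *)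
Lemma CVaR_wball_le0 n N (x : 'I_N -> 'cV[R]_n) (Xi : set 'cV[R]_n) r
    (alpha eps K tau : R) (s : 'I_N -> R) (F : 'cV[R]_n -> R)
    (Q : probability (borel R n) R) :
  (0 < N)%N -> (1 <= r)%E -> 0 < alpha -> (forall i, Xi (x i)) -> 0 <= K ->
  (forall y z, `|F y - F z| <= K * rnorm r (y - z)) ->
  wball Xi r eps (empirical x) Q ->
  - tau * alpha + K * eps + N%:R^-1 * (\sum_i s i) <= 0 ->
  (forall i, tau + F (x i) <= s i) -> (forall i, 0 <= s i) ->
  (CVaR alpha Q F <= 0)%E.
Proof.
move=> N0 r1 a0 Xx K0 FK QB feas sF s0; apply: ge_ereal_inf.
exists (((- tau)%:E + (alpha^-1)%:E *
  'E_Q[fun w => (Num.max (F w - - tau) 0)%R])%E); first by exists (- tau).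
(* Shifting and taking the positive part preserve the Lipschitz bound. *)
have maxK y z : `|Num.max (F y - - tau) 0 - Num.max (F z - - tau) 0|
    <= K * rnorm r (y - z).
  apply: le_trans (FK y z); rewrite ler_norml.
  by have := ler_norm (F y - F z); have := ler_norm (- (F y - F z));
    rewrite normrN; case: (lerP (F y - - tau) 0); case: (lerP (F z - - tau) 0); lra.
have max0 y : 0 <= Num.max (F y - - tau) 0 by rewrite le_max lexx orbT.
have := wball_expectation_le N0 r1 Xx K0 max0 maxK QB.
have sum_le : \sum_i Num.max (F (x i) + tau) 0 <= \sum_i s i.
  by apply: ler_sum => i _; rewrite ge_max s0 addrC sF.
have ai0 : (0 <= (alpha^-1)%:E :> \bar R)%E by rewrite lee_fin invr_ge0 ltW.
move=> /(lee_wpmul2l ai0)/(leeD2l (- tau)%:E)/le_trans; apply.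
rewrite -EFinM -EFinD lee_fin addrC -lerBrDr sub0r opprK ler_pdivrMl//.
have : N%:R^-1 * (\sum_i Num.max (F (x i) + tau) 0) <= N%:R^-1 * (\sum_i s i).
  by rewrite ler_wpM2l// invr_ge0.
move: feas. lra.
Qed.

End risk.

Theorem mainTheorem2 (R : realType) (m p Tini Tf T N : nat)
    (kappa := (T %/ (Tini + Tf))%N)
    (r : \bar R) (alpha eps Lobj Lcon : R)
    (uhat : 'I_T -> 'cV[R]_m)
    (uini : 'cV[R]_(m * Tini)) (yini : 'cV[R]_(p * Tini))
    (U : set 'cV[R]_(m * Tf))
    (Xi : set 'cV[R]_(p * (Tini + Tf) * kappa))
    (xihat : 'I_N -> 'cV[R]_(p * (Tini + Tf) * kappa))
    (f1 : 'cV[R]_(m * Tf) -> R) (f2 : 'cV[R]_(p * Tf) -> R)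
    (f3 : 'cV[R]_(p * Tini) -> R) (h : 'cV[R]_(p * Tf) -> R)
    (Up := past (page (Tini + Tf) uhat)) (Uf := future (page (Tini + Tf) uhat))
    (B := wball Xi r eps (empirical xihat)) :
  (0 < m)%N -> (0 < p)%N -> (0 < Tini)%N -> (0 < Tf)%N -> (0 < T)%N ->
  (0 < N)%N -> (1 <= kappa)%N ->
  (1 <= r)%E -> 0 < alpha < 1 -> 0 <= eps ->
  (forall i, Xi (xihat i)) ->
  (forall x, 0 <= f1 x) -> (forall x, 0 <= f2 x) -> (forall x, 0 <= f3 x) ->
  convex_function setT f1 -> convex_function setT f2 ->
  convex_function setT f3 -> convex_function setT h ->
  lipschitz_continuous r f2 -> lipschitz_continuous r f3 ->
  lipschitz_continuous r h ->
  0 < Lobj ->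
  lipschitz_constant r
    (fun z : 'cV[R]_(p * Tf + p * Tini) => f2 (usubmx z) + f3 (dsubmx z)) Lobj ->
  0 < Lcon -> lipschitz_constant r h Lcon ->
  [/\ (robust_value Up Uf uini yini U f1 f2 f3 h alpha B
       <= tractable_value Up Uf uini yini U f1 f2 f3 h r alpha eps Lobj Lcon
            xihat)%E,
      forall g tau s,
        tractable_optimizer Up Uf uini yini U f1 f2 f3 h r alpha eps Lobj Lcon
          xihat g tau s ->
        forall Q, B Q -> (CVaR alpha Q (fun xi => h (Yf xi *m g)) <= 0)%E
    & Xi = setT ->
      forall g, (tractable_objective Uf yini f1 f2 f3 r eps Lobj xihat g)%:E
                = robust_objective Uf yini f1 f2 f3 B g].
Proof.
move=> m0 p0 Tini0 Tf0 T0 N0 kappa1 r1 /andP[alpha0 alpha1] eps0 Xix f10 f20 f30.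
move=> cf1 cf2 cf3 ch lf2 lf3 lh Lobj0 LobjP Lcon0 [[_ hLcon] _].
(* The input cost is constant in the outputs: added to the output cost it changes neither convexity
   nor the smallest Lipschitz constant. *)
pose ell (g : 'cV[R]_kappa) (z : 'cV[R]_(p * Tf + p * Tini)) :=
  f1 (Uf *m g) + (f2 (usubmx z) + f3 (dsubmx z)).
pose Z (g : 'cV[R]_kappa) := outputs (p := p) (Tini := Tini) (Tf := Tf) g yini.
have ell0 g z : 0 <= ell g z by rewrite !addr_ge0.
have ellL g : lipschitz_constant r (ell g) Lobj.
  have ellB x y : ell g x - ell g y =
      f2 (usubmx x) + f3 (dsubmx x) - (f2 (usubmx y) + f3 (dsubmx y)).
    by rewrite /ell opprD addrACA subrr add0r.
  case: LobjP => [[_ bound] least]; split.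
    by split=> [|x y]; [exact: ltW|rewrite ellB; exact: bound].
  move=> K [K0 KP]; apply: least; split => // x y; rewrite -ellB; exact: KP.
have cell g s x y : 0 <= s <= 1 ->
    ell g (s *: x + (1 - s) *: y) <= s * ell g x + (1 - s) * ell g y.
  move=> s01.
  have h2 := convex_function_le (usubmx x) (usubmx y) cf2 s01.
  have h3 := convex_function_le (dsubmx x) (dsubmx y) cf3 s01.
  have -> : ell g (s *: x + (1 - s) *: y) = f1 (Uf *m g) +
      (f2 (s *: usubmx x + (1 - s) *: usubmx y) +
       f3 (s *: dsubmx x + (1 - s) *: dsubmx y)).
    by rewrite /ell -!linearZ -!linearD.
  rewrite /ell; lra.
have dual0 (g : 'cV[R]_kappa) : 0 <= dual_rnorm r g by exact: rnorm_ge0.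
have ZL (f : 'cV[R]_(p * Tf + p * Tini) -> R) K g : lipschitz_bound r f K ->
    forall y z, `|f (Z g y) - f (Z g z)| <= K * dual_rnorm r g * rnorm r (y - z).
  move=> [K0 fK] y z; apply: (le_trans (fK _ _)).
  by rewrite -mulrA ler_wpM2l// rnorm_outputsB.
have objE g : tractable_objective Uf yini f1 f2 f3 r eps Lobj xihat g =
    N%:R^-1 * (\sum_i ell g (Z g (xihat i))) + Lobj * eps * dual_rnorm r g.
  rewrite /tractable_objective; congr (_ + _).
  rewrite [in RHS]big_split/= sumr_const card_ord -[f1 _ *+ N]mulr_natl mulrDr mulKf.
    by congr (_ + _ * _); apply: eq_bigr => i _; rewrite col_mxKu col_mxKd.
  by rewrite pnatr_eq0 -lt0n.
have EE g (Q : probability (borel R (p * (Tini + Tf) * kappa)) R) :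
    'E_Q[fun xi : 'cV[R]_(p * (Tini + Tf) * kappa) => (f1 (Uf *m g) + f2 (Yf xi *m g)
      + f3 (Yp xi *m g - yini))%R]%E = 'E_Q[ell g \o Z g]%E.
  congr ('E_Q[_]%E); apply/funext => xi.
  by rewrite /ell/= col_mxKu col_mxKd addrA.
have obj_le g : (robust_objective Uf yini f1 f2 f3 B g <=
    (tractable_objective Uf yini f1 f2 f3 r eps Lobj xihat g)%:E)%E.
  apply: ge_ereal_sup => _ [Q QB <-]; rewrite EE objE.
  rewrite -mulrA [eps * _]mulrC mulrA.
  apply: (wball_expectation_le N0 r1 Xix _ _ _ QB).
  - by rewrite mulr_ge0// ltW.
  - by move=> xi; exact: ell0.
  - exact: ZL (ellL g).1.
have cvar_le g tau s :
    tractable_feasible Up Uf uini U h r alpha eps Lcon xihat g tau s ->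
    forall Q, B Q -> (CVaR alpha Q (fun xi => h (Yf xi *m g)) <= 0)%E.
  move=> [_ _ feas hs s0] Q QB.
  apply: (CVaR_wball_le0 (K := Lcon * dual_rnorm r g) (tau := tau)
    N0 r1 alpha0 Xix _ _ QB _ hs s0).
  - by rewrite mulr_ge0// ltW.
  (* [h] is extended to both output blocks so that [ZL] applies; projecting on the future block does
     not increase the norm. *)
  - have hL : lipschitz_bound r (fun z : 'cV[R]_(p * Tf + p * Tini) =>
        h (usubmx z)) Lcon.
      split=> [|x y]; first exact: ltW.
      apply: (le_trans (hLcon _ _)); rewrite ler_wpM2l ?(ltW Lcon0)//.
      by rewrite -linearB rnorm_usubmx.
    by move=> y z; have := ZL _ _ g hL y z; rewrite !col_mxKu.
  - by rewrite -mulrA [dual_rnorm _ _ * _]mulrC mulrA.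
split.
(* Each [g] feasible for (T) is feasible for (R), where its objective is no larger. *)
- apply: le_ereal_inf_tmp => _ [g [tau [s feas]] <-].
  apply: ge_ereal_inf; exists (robust_objective Uf yini f1 f2 f3 B g).
    exists g => //; case: (feas) => Ug Ufg _ _ _; split => //.
    by apply: ge_ereal_sup => _ [Q QB <-]; exact: cvar_le feas _ QB.
  exact: obj_le.
- by move=> g tau s [feas _]; exact: cvar_le feas.
(* The reverse inequality, up to an arbitrary [e]: perturbations [d w^T] with [w] extremal for [g]
   realize the gain [dual_rnorm r g]. *)
move=> XiT g; apply/eqP; rewrite eq_le obj_le andbT.
apply/lee_addgt0Pr => e e0.
have [w w1 wg] := dual_rnorm_attained g r1.
have Vle (d : 'cV[R]_(p * Tf + p * Tini)) :
    rnorm r (stack (assemble d *m w^T)) <= rnorm r d.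
  by rewrite rnorm_stack// rnorm_assemble// ler_piMl ?rnorm_ge0.
have [Q QB QE] := wball_expectation_ge xihat N0 r1 eps0 Lobj0 (dual0 g) e0
  (cell g) (ellL g) (ell0 g)
  (fun xi xi' => rnorm_outputsB g yini xi xi' r1) Vle
  (fun xi s d => outputs_rank1 yini xi s d wg).
rewrite objE -leeBlDr// -EFinB; apply: (le_trans QE).
apply: ereal_sup_ubound; exists Q; last exact: EE.
by rewrite /B XiT.
Qed.
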